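(* Let $\alpha:T_1\to T_2$ be a monomorphism of directed trees. Then $$V_{T_1}(v;F)\mapsto\alpha_*\bigl(V_{T_1}(v;F)\bigr)\equiv V_{T_2}\bigl(\alpha(v);\alpha(F)\bigr),\qquad \bigcup_iB_i\mapsto\bigcup_i\alpha_*(B_i)$$ ($v\in T_1^0$, $F\subseteq\Delta_{1,T_1}(v)$ finite; $\{B_i\}\subseteq\mathcal E(T_1)$ finite and disjoint) defines a Boolean ring monomorphism $\alpha_*:\mathcal A(T_1)\to\mathcal A(T_2)$.
   Context: A graph $T$ consists of a set $T^0$ of vertices, a set $T^1$ of edges, maps $o,t:T^1\to T^0$, and a reversal $e\mapsto\overline e$ on $T^1$ with $\overline{\overline e}=e$, $\overline e\ne e$, $o(\overline e)=t(e)$. A directed graph is a graph with a subset $T^1_+\subseteq T^1$ containing exactly one edge from each pair $\{e,\overline e\}$. (No finiteness or countability assumptions.) A path is a sequence $e_1e_2\cdots$ of edges with $t(e_{i-1})=o(e_i)$ and $e_i\ne\overline{e_{i-1}}$ for $i>1$; vertices are paths of length $0$; it is directed if all $e_i\in T^1_+$ (length-zero paths are directed). $T^*$ (resp. $T^*_+$) is the set of finite (resp. finite directed) paths. $T$ is a tree if for all $u,v\in T^0$ there is a unique $p\in T^*$ with $o(p)=u$, $t(p)=v$. A morphism of directed graphs is a pair of maps on vertices and on edges intertwining $o$, $t$ and reversal and mapping directed edges to directed edges; it is a monomorphism if it is injective on vertices and on edges. For $v\in T^0$: $\Delta_{1}(v)=\Delta_{1,T}(v)=\{e\in T^1_+: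 o(e)=v\}$, $V(v)=V_T(v)=\{t(p):p\in T^*_+,\,o(p)=v\}$, and for finite $F\subseteq\Delta_1(v)$, $V_T(v;F)=\{v\}\cup\bigcup_{e\in\Delta_1(v)\setminus F}V_T(t(e))$. Let $\mathcal E(T)=\{V_T(v;F): v\in T^0,\ F\subseteq\Delta_1(v)\text{ finite}\}\cup\{\emptyset\}$ and let $\mathcal A(T)$ be the collection of finite disjoint unions of sets from $\mathcal E(T)$; $\mathcal A(T)$ is a (Boolean) ring of subsets of $T^0$ (closed under finite unions, intersections, and relative complements). A Boolean ring homomorphism preserves $\cup$, $\cap$ and $\setminus$; a monomorphism is an injective one. *)

(* Defs.v *)
From mathcomp Require Import all_boot.
From mathcomp Require Import boolp classical_sets functions cardinality.
From mathcomp Require Import measurable_structure.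

Set Implicit Arguments.
Unset Strict Implicit.
Unset Printing Implicit Defensive.

Local Open Scope classical_set_scope.

Record graph := Graph {
  vertex : Type;
  edge : Type;
  org : edge -> vertex;
  trm : edge -> vertex;
  rev : edge -> edge;
  revK : involutive rev;
  rev_neq : forall e, rev e <> e;
  org_rev : forall e, org (rev e) = trm e }.

Record digraph := Digraph {
  digraph_graph :> graph;
  pos_edge : set (edge digraph_graph);
  pos_edge_ex : forall e, pos_edge e \/ pos_edge (rev e);
  pos_edge_excl : forall e, ~ (pos_edge e /\ pos_edge (rev e)) }.

Arguments pos_edge : clear implicits.

Section Paths.
Variable G : graph.

(* A candidate path is a pair (start vertex, list of edges); the start vertex
   is what distinguishes the paths of length 0. *)
Definition porg (p : vertex G * seq (edge G)) : vertex G := p.1.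
Definition ptrm (p : vertex G * seq (edge G)) : vertex G :=
  last p.1 [seq trm e | e <- p.2].

Definition step (e f : edge G) : bool := `[< trm e = org f /\ f <> rev e >].

Definition is_path (p : vertex G * seq (edge G)) : Prop :=
  (if p.2 is e :: _ then org e = p.1 else True) /\ sorted step p.2.

Definition is_tree : Prop :=
  forall u v : vertex G, exists! p, [/\ is_path p, porg p = u & ptrm p = v].

End Paths.

Section DirectedGraph.
Variable T : digraph.

Definition is_dipath (p : vertex T * seq (edge T)) : Prop :=
  is_path p /\ all (fun e => e \in pos_edge T) p.2.

Definition Delta1 (v : vertex T) : set (edge T) :=
  [set e | pos_edge T e /\ org e = v].

Definition V (v : vertex T) : set (vertex T) :=
  [set ptrm p | p in [set p | is_dipath p /\ porg p = v]].

Definition VF (v : vertex T) (F : set (edge T)) : set (vertex T) :=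
  [set v] `|` \bigcup_(e in Delta1 v `\` F) V (trm e).

Definition calE : set (set (vertex T)) :=
  [set A | exists v F, [/\ F `<=` Delta1 v, finite_set F & A = VF v F]]
  `|` [set set0].

Definition calA : set (set (vertex T)) :=
  [set A | exists (n : nat) (B : 'I_n -> set (vertex T)),
    [/\ forall i, calE (B i), trivIset setT B & A = \bigcup_i B i]].

End DirectedGraph.

Arguments calE : clear implicits.
Arguments calA : clear implicits.

Record dimorphism (T1 T2 : digraph) := DiMorphism {
  on_vertex : vertex T1 -> vertex T2;
  on_edge : edge T1 -> edge T2;
  on_edge_org : forall e, org (on_edge e) = on_vertex (org e);
  on_edge_trm : forall e, trm (on_edge e) = on_vertex (trm e);
  on_edge_rev : forall e, on_edge (rev e) = rev (on_edge e);
  on_edge_pos : forall e, pos_edge T1 e -> pos_edge T2 (on_edge e) }.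

Definition monomorphism (T1 T2 : digraph) (alpha : dimorphism T1 T2) : Prop :=
  injective (on_vertex alpha) /\ injective (on_edge alpha).

(* A map between rings of sets R and S is represented by a function on all
   sets, of which only the values on R are meaningful. *)
Definition boolean_ring_hom (X Y : Type) (R : set (set X)) (S : set (set Y))
    (f : set X -> set Y) : Prop :=
  [/\ setring R, setring S, set_fun R S f &
   forall A B, R A -> R B ->
     [/\ f (A `|` B) = f A `|` f B,
         f (A `&` B) = f A `&` f B &
         f (A `\` B) = f A `\` f B]].

Definition boolean_ring_mono (X Y : Type) (R : set (set X)) (S : set (set Y))
    (f : set X -> set Y) : Prop :=
  boolean_ring_hom R S f /\ set_inj R f.

(* The empty family (n = 0) gives f set0 = set0. *)
Definition star_formulas (T1 T2 : digraph) (alpha : dimorphism T1 T2)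
    (f : set (vertex T1) -> set (vertex T2)) : Prop :=
  (forall (v : vertex T1) (F : set (edge T1)),
     F `<=` Delta1 v -> finite_set F ->
     f (VF v F) = VF (on_vertex alpha v) (on_edge alpha @` F)) /\
  (forall (n : nat) (B : 'I_n -> set (vertex T1)),
     (forall i, calE T1 (B i)) -> trivIset setT B ->
     f (\bigcup_i B i) = \bigcup_i f (B i)).

(* Main.v *)
(* Every vertex w of T2 which is the end of a directed path starting in
   alpha(T1) is the end of such a path
   whose first edge, if any, is not in alpha(T1).
   Since T2 is a tree, the origin alpha(u) of the latter is unique; call fiber of
   u the set of all w with origin alpha(u).  Then alpha_*(A) is the union of the
   fibers of the points of A, and as the fibers are disjoint and nonempty this
   preserves unions, intersections and differences, and is injective.

   That A(T) is a ring rests on the shape of reduced paths: if V(v) and V(w) meet,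
   the path from v to w goes forward up to some m and then backward, and
   V(v) and V(w) intersect in V(m).  Differences are computed by
   peeling off one cone per edge of the directed path from v to m. *)

Require Import Defs.
From mathcomp Require Import all_boot.
From mathcomp Require Import boolp classical_sets functions cardinality.
From mathcomp Require Import measurable_structure.

Set Implicit Arguments.
Unset Strict Implicit.
Unset Printing Implicit Defensive.

Local Open Scope classical_set_scope.

(** * Finite disjoint unions of sets from a family, and when they form a ring *)

Lemma finite_set_induction (T : Type) (P : set T -> Prop) :
  P set0 -> (forall x A, P A -> P (x |` A)) -> forall A, finite_set A -> P A.
Proof.
(* Membership in a sequence needs an equality on [T]; [Pchoice] replaces the bare type by one with a
   choice structure. *)
elim/Pchoice: T P => T P P0 PU A /finite_seqP [s ->{A}].
elim: s => [|x s IHs]; first by rewrite set_nil.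
rewrite (_ : [set` x :: s] = x |` [set` s]); first exact: PU.
by apply/seteqP; split=> y /=; rewrite inE => /predU1P.
Qed.

Section DisjointUnions.
Variables (X : Type) (G : set (set X)).

(** Adds one set at a time, so that closure properties follow by induction; [calAE] identifies this
    form with the indexed one of [calA]. *)
Inductive disj_union : set X -> Prop :=
| disj_union0 : disj_union set0
| disj_unionU A B : disj_union A -> G B -> A `&` B = set0 ->
    disj_union (A `|` B).

Lemma disj_union_gen A : G A -> disj_union A.
Proof.
move=> GA; rewrite -(set0U A).
by apply: disj_unionU => //; [exact: disj_union0|rewrite set0I].
Qed.

Lemma disj_union_setU A B : disj_union A -> disj_union B -> A `&` B = set0 ->
  disj_union (A `|` B).
Proof.
move=> dA; elim=> [|{}B C dB IHB GC BC0] AB0; first by rewrite setU0.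
move: AB0; rewrite setIUr setU_eq0 => -[AB0 AC0].
rewrite setUA; apply: disj_unionU => //; first exact: IHB.
by rewrite setIUl AC0 BC0 setU0.
Qed.

Hypothesis GD : forall A B, G A -> G B -> disj_union (A `\` B).

(** Subtracting a disjoint union amounts to subtracting its pieces one after the other, and a union
    becomes disjoint once [B] is removed from [A]. *)
Lemma disj_union_setring : setring disj_union.
Proof.
have DG A B : disj_union A -> G B -> disj_union (A `\` B).
  move=> dA GB; elim: dA => [|{}A C dA IHA GC AC0].
    by rewrite set0D; exact: disj_union0.
  rewrite setDUD; apply: disj_union_setU => //; first exact: GD.
  by apply: subsetI_eq0 AC0; exact: subDsetl.
have D A B : disj_union A -> disj_union B -> disj_union (A `\` B).
  move=> dA dB; elim: dB => [|{}B C dB IHB GC _]; first by rewrite setD0.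
  by rewrite -setDDl; exact: DG.
split=> // [|A B dA dB]; first exact: disj_union0.
rewrite (_ : A `|` B = (A `\` B) `|` B); last first.
  by rewrite setUDl setDv setD0.
by apply: disj_union_setU => //; [exact: D|exact: setDKI].
Qed.

End DisjointUnions.

(** * Walks and backtracking in an undirected graph *)

Section Walks.
Variable T : graph.
Implicit Types (v w m : vertex T) (e f : edge T) (p q r : seq (edge T)).

(** Incidence is separated from [reduced], since walks concatenate freely while reduced ones do not;
    [is_pathP] recovers paths from the two conditions. *)
Fixpoint walk v p w : Prop :=
  if p is e :: p' then org e = v /\ walk (trm e) p' w else v = w.

Definition turns e f : bool := `[< f <> Defs.rev e >].

Definition reduced p : bool := sorted turns p.

Definition rev_walk p := map (@Defs.rev T) (seq.rev p).

Lemma trm_rev e : trm (Defs.rev e) = org e.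
Proof. by rewrite -org_rev Defs.revK. Qed.

Lemma walk_cat v p q w :
  walk v (p ++ q) w <-> exists m, walk v p m /\ walk m q w.
Proof.
elim: p v => [|e p IHp] v /=.
  by split=> [vw|[m [-> //]]]; exists v.
split=> [[<- /IHp[m [pm mq]]]|[m [[<- pm] mq]]]; first by exists m.
by split=> //; apply/IHp; exists m.
Qed.

Lemma walk_last v p w : walk v p w -> last v (map (@trm T) p) = w.
Proof. by elim: p v => //= e p IHp v [_ /IHp]. Qed.

Lemma walk_end v p w w' : walk v p w -> walk v p w' -> w = w'.
Proof. by move=> /walk_last <- /walk_last. Qed.

Lemma walk_rev v p w : walk v p w -> walk w (rev_walk p) v.
Proof.
elim: p v => [|e p IHp] v //= [<- /IHp wp].
rewrite /rev_walk rev_cons map_rcons -cats1; apply/walk_cat.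
by exists (trm e); split=> //=; rewrite org_rev trm_rev.
Qed.

Lemma rev_walk_inj : injective rev_walk.
Proof.
move=> p q /(inj_map (can_inj (@Defs.revK T))).
exact: (can_inj (seq.revK)).
Qed.

Lemma reduced_rev p : reduced p -> reduced (rev_walk p).
Proof.
rewrite /reduced /rev_walk sorted_map rev_sorted.
apply: sub_sorted => e f /asboolP ef; apply/asboolP; rewrite Defs.revK.
exact: nesym.
Qed.

(** At the junction [e] is followed by the inverse of [f], which backtracks only if [e = f]. *)
Lemma reduced_cat_rev p q e f : reduced (rcons p e) -> reduced (rcons q f) ->
  e <> f -> reduced (rcons p e ++ rev_walk (rcons q f)).
Proof.
move=> pe /reduced_rev; rewrite /rev_walk rev_rcons /= => qf ef.
rewrite /reduced sorted_cat_cons; apply/andP; split; last exact: qf.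
rewrite -cats1 cat_rcons sorted_cat_cons [sorted _ _]pe /=.
by rewrite andbT; apply/asboolP => /(can_inj (@Defs.revK T)) /esym/ef.
Qed.

Lemma is_pathP v p w :
  (is_path (v, p) /\ ptrm (v, p) = w) <-> (walk v p w /\ reduced p).
Proof.
have stepP u q : walk u q w -> reduced q -> sorted (@step T) q.
  elim: q u => [|e [|f q] IHq] //= u [_ wq] /andP[/asboolP ef rq].
  apply/andP; split; last exact: IHq wq rq.
  by apply/asboolP; split=> //; case: wq.
split=> [[[/= pv sp] <-]|[wp rp]]; last first.
  split; last exact: walk_last wp.
  by split; [case: p wp {rp} => //= e p []|exact: stepP wp rp].
split; last by apply: sub_sorted sp => e f /asboolP[_ ef]; exact/asboolP.
elim: p v pv sp => //= e p IHp v <- sp; split=> //; apply: IHp.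
  by case: p sp => //= f p /andP[/asboolP[]].
by case: p sp => //= f p /andP[].
Qed.

(* [r] is the longest common suffix of [p] and [q], so that [p0] followed by the
   inverse of [q0] does not backtrack at [m]. *)
Lemma strip_suffix v w x p q : reduced p -> reduced q -> walk v p x ->
  walk w q x -> exists m p0 q0 r, [/\ walk v p0 m /\ walk w q0 m,
    p = p0 ++ r, q = q0 ++ r & reduced (p0 ++ rev_walk q0)].
Proof.
elim/last_ind: p q x => [|p e IHp] q x rp rq vp wq.
  by exists x, [::], q, [::]; split; rewrite ?cats0 //; exact: reduced_rev.
case/lastP: q rq wq => [|q f] rq wq.
  by exists x, (rcons p e), [::], [::]; split; rewrite ?cats0.
have [ef|ef] := pselect (e = f); last first.
  exists x, (rcons p e), (rcons q f), [::].
  by split; rewrite ?cats0 //; exact: reduced_cat_rev.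
have red_rcons s g : reduced (rcons s g) -> reduced s.
  by rewrite -cats1 => /cat_sorted2[].
have walk_rcons u s g y : walk u (rcons s g) y -> walk u s (org g) /\ trm g = y.
  by rewrite -cats1 => /walk_cat[m [us /= [gm gy]]]; rewrite gm.
move: vp wq; rewrite -ef => /walk_rcons[vp _] /walk_rcons[wq _].
have [m [p0 [q0 [r [pq0 -> -> red]]]]] :=
  IHp q (org e) (red_rcons _ _ rp) (red_rcons _ _ rq) vp wq.
by exists m, p0, q0, (rcons r e); split; rewrite ?rcons_cat.
Qed.

End Walks.

(** * Directed walks, and cones as sets of their endpoints *)

Section DirectedWalks.
Variable T : digraph.
Implicit Types (v w m u x : vertex T) (e f : edge T) (p q r : seq (edge T)).
Implicit Types (F K : set (edge T)).

Definition positive p : bool := all (fun e => e \in pos_edge T) p.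

Definition dwalk v p w : Prop := walk v p w /\ positive p.

(** Only the first edge is constrained. This describes [VF v F], and also the fibers when [F] is the
    image of the morphism. *)
Definition avoids F p : Prop := if p is e :: _ then ~ F e else True.

Lemma dwalk0 v w : dwalk v [::] w <-> v = w.
Proof. by split=> [[]|->]. Qed.

Lemma dwalk_cons v e p w :
  dwalk v (e :: p) w <-> Delta1 v e /\ dwalk (trm e) p w.
Proof.
split=> [[[<- wp] /andP[/[!inE] pe pp]]|[[pe <-] [wp pp]]]; first by [].
by split=> //; apply/andP; rewrite inE.
Qed.

Lemma dwalk_cat v p q w :
  dwalk v (p ++ q) w <-> exists m, dwalk v p m /\ dwalk m q w.
Proof.
rewrite /dwalk /positive all_cat; split.
  by move=> [/walk_cat[m [vp mq]] /andP[pp pq]]; exists m.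
move=> [m [[vp pp] [mq pq]]]; split; last by rewrite pp.
by apply/walk_cat; exists m.
Qed.

Lemma avoids_cat F p q :
  avoids F (p ++ q) <-> avoids F p /\ (p = [::] -> avoids F q).
Proof. by case: p => [|e p] /=; split=> // -[] // _ /(_ erefl). Qed.

Lemma avoids0 p : avoids set0 p.
Proof. by case: p => // e p []. Qed.

(** An edge and its inverse are never both positive. *)
Lemma positive_reduced p : positive p -> reduced p.
Proof.
elim: p => //= e [|f p] IHp //= /andP[/set_mem pe pp].
apply/andP; split; last exact: IHp.
apply/asboolP => fe; move: pp => /andP[/set_mem]; rewrite fe => pre _.
by have := @pos_edge_excl T e; exact.
Qed.

Lemma V_dwalk v w : V v w <-> exists p, dwalk v p w.
Proof.
split=> [[[u p] [[pp posp] /= uv] pw]|[p [vp posp]]].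
  by exists p; split=> //; rewrite -uv; apply (is_pathP u p w).
have [pathp trmp] := (is_pathP v p w).2 (conj vp (positive_reduced posp)).
by exists (v, p).
Qed.

Lemma VF_dwalk v F w : VF v F w <-> exists p, dwalk v p w /\ avoids F p.
Proof.
split=> [[->|[e [De nFe] /V_dwalk[p tp]]]|[[|e p] [vp nFp]]].
- by exists [::]; split=> //; apply/dwalk0.
- by exists (e :: p); split=> //; apply/dwalk_cons.
- by left; move/dwalk0: vp.
- by right; move/dwalk_cons: vp => [De tp]; exists e => //; apply/V_dwalk; exists p.
Qed.

(** The cut is visible in the concatenation: [p] is its longest positive prefix, as [rev_walk q] has
    no positive edge. *)
Lemma positive_cat_rev_inj p q p' q' :
  positive p -> positive q -> positive p' -> positive q' ->
  p ++ rev_walk q = p' ++ rev_walk q' -> p = p' /\ q = q'.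
Proof.
have neg e r s t : positive (e :: r) -> positive t -> e :: s <> rev_walk t.
  move=> /andP[/set_mem pe _]; case/lastP: t => // t f.
  rewrite /positive all_rcons /rev_walk rev_rcons /= => /andP[/set_mem pf _].
  by case=> ef _; apply: (@pos_edge_excl T f); rewrite -ef.
elim: p p' => [|e p IHp] [|e' p'] /= pp pq pp' pq'.
- by move/rev_walk_inj.
- by move/esym/(neg _ _ _ _ pp' pq).
- by move/(neg _ _ _ _ pp pq').
- move=> [-> /IHp]; move: pp pp' => /andP[_ pp] /andP[_ pp'].
  by move=> /(_ pp pq pp' pq')[-> ->].
Qed.

End DirectedWalks.

(** * Intersections and differences of cones in a directed tree *)

Section DirectedTree.
Variable T : digraph.
Hypothesis treeT : is_tree T.
Implicit Types (v w m u x y : vertex T) (e f : edge T) (p q r : seq (edge T)).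
Implicit Types (F K : set (edge T)).

Lemma tree_walk v w : exists p, walk v p w /\ reduced p.
Proof.
have [[u p] [[pp + pw] _]] := treeT v w; rewrite /porg /= => uv.
by exists p; apply/is_pathP; rewrite -uv; split.
Qed.

Lemma tree_walk_uniq v w p q :
  walk v p w -> reduced p -> walk v q w -> reduced q -> p = q.
Proof.
move=> vp rp vq rq; have [s [_ s_uniq]] := treeT v w.
have [pp tp] := (is_pathP v p w).2 (conj vp rp).
have [pq tq] := (is_pathP v q w).2 (conj vq rq).
have := s_uniq (v, p) (And3 pp erefl tp).
by rewrite (s_uniq (v, q) (And3 pq erefl tq)) => -[].
Qed.

Lemma dwalk_uniq v w p q : dwalk v p w -> dwalk v q w -> p = q.
Proof.
move=> [vp /positive_reduced rp] [vq /positive_reduced rq].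
exact: tree_walk_uniq vp rp vq rq.
Qed.

(* The reduced walk from [v] to [w] goes positively up to [m], then negatively;
   it does not depend on [x], so neither do [m], [p0] and [q0]. *)
Lemma meet v w x p q : dwalk v p x -> dwalk w q x ->
  exists m p0 q0, [/\ dwalk v p0 m, dwalk w q0 m, reduced (p0 ++ rev_walk q0) &
    forall x' p' q', dwalk v p' x' -> dwalk w q' x' ->
      exists r, [/\ p' = p0 ++ r, q' = q0 ++ r & dwalk m r x']].
Proof.
have strip x1 p1 q1 : dwalk v p1 x1 -> dwalk w q1 x1 ->
    exists m p0 q0 r, [/\ dwalk v p0 m, dwalk w q0 m, dwalk m r x1,
      p1 = p0 ++ r /\ q1 = q0 ++ r & reduced (p0 ++ rev_walk q0)].
  move=> [vp pp] [wq pq].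
  have [m [p0 [q0 [r [[vp0 wq0] Ep Eq red]]]]] :=
    strip_suffix (positive_reduced pp) (positive_reduced pq) vp wq.
  move: pp pq vp wq; rewrite Ep Eq /positive !all_cat.
  move=> /andP[pp0 pr] /andP[pq0 _] /walk_cat[m' [vp0' mr]] _.
  exists m, p0, q0, r; split=> //; split=> //.
  by rewrite (walk_end vp0 vp0').
move=> vp wq; have [m [p0 [q0 [_ [vp0 wq0 _ _ red]]]]] := strip _ _ _ vp wq.
exists m, p0, q0; split=> // x' p' q' vp' wq'.
have [m' [p1 [q1 [r [vp1 wq1 mr [-> ->] red']]]]] := strip _ _ _ vp' wq'.
have bridge m1 s t : dwalk v s m1 -> dwalk w t m1 -> walk v (s ++ rev_walk t) w.
  by move=> [vs _] [wt _]; apply/walk_cat; exists m1; split=> //; exact: walk_rev.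
have E := tree_walk_uniq (bridge _ _ _ vp0 wq0) red (bridge _ _ _ vp1 wq1) red'.
have [Ep Eq] := positive_cat_rev_inj vp0.2 wq0.2 vp1.2 wq1.2 E.
exists r; rewrite Ep Eq; split=> //.
by move: vp1 vp0; rewrite -Ep => -[vp1 _] [vp0 _]; rewrite (walk_end vp0 vp1).
Qed.

(** By [meet], all common points lie beyond one vertex [m]. The walk [p] to [m] is kept because
    differences are computed along it. *)
Lemma VF_setI v w F K x : F `<=` Delta1 v -> finite_set F ->
  K `<=` Delta1 w -> finite_set K -> VF v F x -> VF w K x ->
  exists m L p, [/\ L `<=` Delta1 m, finite_set L, dwalk v p m, avoids F p &
    VF v F `&` VF w K = VF m L].
Proof.
move=> FD Ffin KD Kfin /VF_dwalk[p [vp Fp]] /VF_dwalk[q [wq Kq]].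
have [m [p0 [q0 [vp0 wq0 _ meetP]]]] := meet vp wq.
have [r [Ep Eq mr]] := meetP _ _ _ vp wq.
move: Fp Kq; rewrite Ep Eq => /avoids_cat[Fp0 _] /avoids_cat[Kq0 _].
(* An exclusion concerns the first edge of the whole walk, so [F] constrains the part after [m] only
   if [p0] is empty, and [K] only if [q0] is. *)
pose L := [set e | (p0 = [::] /\ F e) \/ (q0 = [::] /\ K e)].
have avoidsL s : avoids L s <-> (p0 = [::] -> avoids F s) /\ (q0 = [::] -> avoids K s).
  case: s => [|e s] //=; split=> [nLe|[nFe nKe] [] [E]].
    by split=> E ?; apply: nLe; [left|right].
  - exact: nFe.
  - exact: nKe.
exists m, L, p0; split=> //.
- move=> e [] [E].
    by move: vp0; rewrite E => /dwalk0 <- /FD.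
  by move: wq0; rewrite E => /dwalk0 <- /KD.
- apply: (@sub_finite_set _ _ (F `|` K)); last by rewrite finite_setU.
  by move=> e [] [_]; [left|right].
apply/seteqP; split=> y.
  move=> [/VF_dwalk[p' [vp' Fp']] /VF_dwalk[q' [wq' Kq']]].
  have [s [E1 E2 ms]] := meetP _ _ _ vp' wq'.
  move: Fp' Kq'; rewrite E1 E2 => /avoids_cat[_ Fs] /avoids_cat[_ Ks].
  by apply/VF_dwalk; exists s; split=> //; apply/avoidsL.
move=> /VF_dwalk[s [ms /avoidsL[Fs Ks]]]; split; apply/VF_dwalk.
  exists (p0 ++ s); split; last exact/avoids_cat.
  by apply/dwalk_cat; exists m.
exists (q0 ++ s); split; last exact/avoids_cat.
by apply/dwalk_cat; exists m.
Qed.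

Lemma calE_VF v F : F `<=` Delta1 v -> finite_set F -> calE T (VF v F).
Proof. by move=> FD Ffin; left; exists v, F. Qed.

Lemma calE_V0 v : calE T (VF v set0).
Proof. exact: calE_VF. Qed.

Lemma VF0_VF v F e : Delta1 v e -> ~ F e -> VF (trm e) set0 `<=` VF v F.
Proof.
move=> De nFe y /VF_dwalk[p [ep _]]; apply/VF_dwalk; exists (e :: p).
by split=> //; apply/dwalk_cons.
Qed.

Lemma VF_setD1 v F e : Delta1 v e -> ~ F e ->
  VF v F = VF v (e |` F) `|` VF (trm e) set0.
Proof.
move=> De nFe; apply/seteqP; split=> y.
  move=> /VF_dwalk[[|f p] [vp Fp]]; first by left; left; move/dwalk0: vp.
  have [fe|fe] := pselect (f = e).
    right; apply/VF_dwalk; exists p; move: vp; rewrite fe => /dwalk_cons[_ ?].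
    by split=> //; exact: avoids0.
  by left; apply/VF_dwalk; exists (f :: p); split=> // -[].
move=> [|/(VF0_VF De nFe) //] /VF_dwalk[p [vp Fp]]; apply/VF_dwalk; exists p.
by split=> //; case: p Fp {vp} => //= f p Fp Ff; apply: Fp; right.
Qed.

(** A common point would be reached from [v] both by a walk avoiding [e] and by one starting with
    [e], against uniqueness. *)
Lemma VF_disj v F e : Delta1 v e -> F e -> VF v F `&` VF (trm e) set0 = set0.
Proof.
move=> De Fe; rewrite -subset0 => y [/VF_dwalk[p [vp Fp]] /VF_dwalk[q [eq _]]].
have /(dwalk_uniq vp) E : dwalk v (e :: q) y by apply/dwalk_cons.
by move: Fp; rewrite E; exact.
Qed.

(** The only directed walk from [v] to a point of [VF v F] already avoids [F]. This reduces
    differences at one vertex to nested cones. *)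
Lemma VF_setU v F K : VF v F `\` VF v K = VF v F `\` VF v (F `|` K).
Proof.
apply/seteqP; split=> y [Fy Ky]; split=> // /VF_dwalk[p [vp ap]]; apply: Ky;
  apply/VF_dwalk; exists p; split=> //.
  by case: p ap {vp} => //= e p ap Ke; apply: ap; right.
move: Fy => /VF_dwalk[q [vq aq]]; move: aq ap; rewrite (dwalk_uniq vq vp).
by case: (p) => //= e s nFe nKe [].
Qed.

Lemma VF_setD_same v F K : F `<=` Delta1 v -> finite_set F ->
  K `<=` Delta1 v -> finite_set K ->
  disj_union (calE T) (VF v F `\` VF v K).
Proof.
move=> FD Ffin KD Kfin; move: FD Ffin KD; rewrite VF_setU.
(* [F] stays general because each peeled edge moves from [K] into [F], splitting off its full
   cone. *)
elim/finite_set_induction: K / Kfin => [|e K IHK] in F *.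
  by rewrite setU0 setDv => *; exact: disj_union0.
move=> FD Ffin KD; have De : Delta1 v e by apply: KD; left.
have {}KD : K `<=` Delta1 v by move=> f Kf; apply: KD; right.
have [Fe|nFe] := pselect (F e).
  rewrite (_ : F `|` (e |` K) = F `|` K); first exact: IHK.
  by rewrite setUA [F `|` [set e]]setUidl // => _ ->.
have V0 : VF v (F `|` (e |` K)) `&` VF (trm e) set0 = set0.
  by apply: VF_disj => //; right; left.
rewrite (VF_setD1 De nFe) setDUD; apply: disj_union_setU.
- rewrite [F `|` _]setUCA setUA; apply: IHK => //; last first.
    by rewrite finite_setU.
  by move=> f [->|/FD].
- by rewrite (setDidl (etrans (setIC _ _) V0)); apply/disj_union_gen/calE_V0.
- by apply: subsetI_eq0 (@VF_disj v (e |` F) e De (or_introl erefl)); exact: subDsetl.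
Qed.

Lemma VF_setD_dwalk p v m F K : dwalk v p m -> avoids F p ->
  F `<=` Delta1 v -> finite_set F -> K `<=` Delta1 m -> finite_set K ->
  disj_union (calE T) (VF v F `\` VF m K).
Proof.
elim: p v F => [|e p IHp] v F.
  move=> /dwalk0 <- _; exact: VF_setD_same.
move=> /dwalk_cons[De ep] nFe FD Ffin KD Kfin.
have Km : VF m K `<=` VF (trm e) set0.
  move=> y /VF_dwalk[q [mq _]]; apply/VF_dwalk; exists (p ++ q).
  by split; [apply/dwalk_cat; exists m|exact: avoids0].
rewrite (VF_setD1 De nFe) setDUD; apply: disj_union_setU.
- rewrite (_ : _ `\` _ = VF v (e |` F)).
    by apply/disj_union_gen/calE_VF; [move=> f [->|/FD]|rewrite finite_setU].
  by apply: setDidl; apply: subsetI_eq0 (@VF_disj v (e |` F) e De (or_introl erefl)).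
- by apply: IHp => //; exact: avoids0.
- by apply: subsetI_eq0 (@VF_disj v (e |` F) e De (or_introl erefl)); exact: subDsetl.
Qed.

Lemma calE_setD A B : calE T A -> calE T B -> disj_union (calE T) (A `\` B).
Proof.
move=> [[v [F [FD Ffin ->]]]|->]; last by rewrite set0D => _; exact: disj_union0.
move=> [[w [K [KD Kfin ->]]]|->]; last first.
  by rewrite setD0; apply: disj_union_gen; exact: calE_VF.
have [I0|/set0P[x [Fx Kx]]] := eqVneq (VF v F `&` VF w K) set0.
  by rewrite (setDidl I0); apply: disj_union_gen; exact: calE_VF.
have [m [L [p [LD Lfin vp Fp E]]]] := VF_setI FD Ffin KD Kfin Fx Kx.
(* Only the intersection is really removed, and it is a cone at a vertex reached from [v]. *)
rewrite (_ : _ `\` _ = VF v F `\` (VF v F `&` VF w K)); last first.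
  by rewrite setDIr setDv set0U.
by rewrite E; exact: VF_setD_dwalk vp Fp FD Ffin LD Lfin.
Qed.

(** In both directions, index [ord0] carries the last set added and [lift ord0] the earlier ones. *)
Lemma calAE : calA T = disj_union (calE T).
Proof.
apply/seteqP; split=> A.
  move=> [n [B [BE Btriv ->{A}]]]; elim: n B BE Btriv => [|n IHn] B BE Btriv.
    rewrite (_ : \bigcup_i B i = set0); first exact: disj_union0.
    by rewrite -subset0 => x [[]].
  have -> : \bigcup_i B i = \bigcup_i B (lift ord0 i) `|` B ord0.
    apply/seteqP; split=> x.
      move=> [i _ Bx]; case: (unliftP ord0 i) Bx => [j|] ->; last by right.
      by left; exists j.
    by move=> [[j _ Bx]|Bx]; [exists (lift ord0 j)|exists ord0].
  apply: disj_unionU => //.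
    by apply: IHn => // i j _ _ ij; apply: (@lift_inj _ ord0); exact: Btriv.
  rewrite -subset0 => x [[j _ Bj] B0].
  have : lift ord0 j = ord0 by apply: Btriv => //; exists x.
  by move/eqP; rewrite eq_sym (negbTE (neq_lift _ _)).
elim=> [|{}A C _ [n [B [BE Btriv ->]]] CE BC0].
  by exists 0, (fun=> set0); split=> //; [case|case|rewrite bigcup0].
exists n.+1, (fun i => if unlift ord0 i is Some j then B j else C); split.
- by move=> i; case: unliftP.
- have BC j : B j `&` C = set0.
    by apply: subsetI_eq0 BC0 => // x Bx; exists j.
  move=> i j _ _; case: unliftP => [i' ->|->]; case: unliftP => [j' ->|->] //.
  + by move=> BB; rewrite (Btriv i' j').
  + by rewrite BC => -[].
  + by rewrite setIC BC => -[].
apply/seteqP; split=> x.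
  move=> [[i _ Bx]|Cx]; first by exists (lift ord0 i); rewrite ?liftK.
  by exists ord0; rewrite ?unlift_none.
by move=> [i _]; case: unliftP => [j _ Bx|_ Cx]; [left; exists j|right].
Qed.

Lemma calA_setring : setring (calA T).
Proof. by rewrite calAE; apply: disj_union_setring; exact: calE_setD. Qed.

End DirectedTree.

(** * Fibers over the image of a monomorphism, and the induced map *)

Section Monomorphism.
Variables (T1 T2 : digraph) (alpha : dimorphism T1 T2).
Hypotheses (treeT1 : is_tree T1) (treeT2 : is_tree T2).
Hypothesis alpha_mono : monomorphism alpha.
Implicit Types (u v : vertex T1) (w : vertex T2) (A B : set (vertex T1)).

Let aV := on_vertex alpha.
Let aE := on_edge alpha.

Definition fiber u : set (vertex T2) :=
  [set w | exists p, dwalk (aV u) p w /\ avoids (range aE) p].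

Definition star A : set (vertex T2) := \bigcup_(u in A) fiber u.

Lemma walk_map u p v : walk u p v -> walk (aV u) (map aE p) (aV v).
Proof.
elim: p u => [|e p IHp] u /=; first by move=> ->.
by move=> [<- /IHp]; rewrite on_edge_org on_edge_trm.
Qed.

Lemma reduced_map p : reduced p -> reduced (map aE p).
Proof.
rewrite /reduced sorted_map; apply: sub_sorted => e f /asboolP ef.
by apply/asboolP; rewrite -on_edge_rev => /alpha_mono.2.
Qed.

Lemma dwalk_map u p v : dwalk u p v -> dwalk (aV u) (map aE p) (aV v).
Proof.
move=> [up pp]; split; first exact: walk_map.
rewrite /positive all_map; apply: sub_all pp => e /set_mem pe.
by apply/mem_set/on_edge_pos.
Qed.

(** Positivity is reflected: if [e] were not positive, [rev e] would be, and then so would the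
    inverse of [aE e]. *)
Lemma Delta1_on_edge v e : Delta1 (aV v) (aE e) <-> Delta1 v e.
Proof.
split=> [[pe oe]|[pe <-]]; last by split; [exact: on_edge_pos|exact: on_edge_org].
split; last by apply: alpha_mono.1; rewrite -on_edge_org.
have [//|pre] := pos_edge_ex e.
case: (@pos_edge_excl T2 (aE e)); split=> //.
by rewrite -on_edge_rev; exact: on_edge_pos.
Qed.

Lemma fiber_on_vertex u : fiber u (aV u).
Proof. by exists [::]; split=> //; apply/dwalk0. Qed.

(* The reduced walk from [aV u] to [aV u'] is the image of a walk in [T1], but
   a common point of the fibers makes its first edge or the inverse of its last
   edge avoid that image. *)
Lemma fiber_inj u u' w : fiber u w -> fiber u' w -> u = u'.
Proof.
move=> [p [up ap]] [p' [up' ap']].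
have [m [q [q' [uq uq' red /(_ _ _ _ up up')]]]] := meet treeT2 up up'.
move=> [r [Ep Ep' _]].
move: ap ap'; rewrite Ep Ep' => /avoids_cat[aq _] /avoids_cat[aq' _].
have [s [us rs]] := tree_walk treeT1 u u'.
have E : q ++ rev_walk q' = map aE s.
  apply: (tree_walk_uniq treeT2 _ red (walk_map us) (reduced_map rs)).
  by apply/walk_cat; exists m; split; [exact: uq.1|exact: walk_rev uq'.1].
case: q uq aq E {Ep red} => [|e q] uq aq E; last first.
  by case: s E {us rs} => // f s [ef _]; case: aq; exists f.
case: q' uq' aq' E {Ep'} => [|e q'] uq' aq' E.
  move/dwalk0: uq => um; move/dwalk0: uq' => u'm.
  by apply: alpha_mono.1; exact: etrans um (esym u'm).
move: E => /(congr1 seq.rev); rewrite /= /rev_walk -map_rev seq.revK -map_rev.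
case: (seq.rev s) => // f t [ef _]; case: aq'; exists (Defs.rev f) => //.
by rewrite /aE on_edge_rev -/aE -ef Defs.revK.
Qed.

(** Cut [p] at the first edge outside the image; the edges before it lift one by one through
    [Delta1_on_edge]. *)
Lemma dwalk_split v p w : dwalk (aV v) p w ->
  exists q u r, [/\ p = map aE q ++ r, dwalk v q u, dwalk (aV u) r w &
    avoids (range aE) r].
Proof.
elim: p v => [|e p IHp] v vp.
  by exists [::], v, [::]; split=> //; apply/dwalk0.
have [[f _ fe]|nRe] := pselect (range aE e); last first.
  by exists [::], v, (e :: p); split=> //; apply/dwalk0.
move: vp; rewrite -fe => /dwalk_cons[/Delta1_on_edge Df].
rewrite on_edge_trm => /IHp[q [u [r [-> vq ur ar]]]].
by exists (f :: q), u, r; split=> //; apply/dwalk_cons.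
Qed.

(** A directed walk from [aV v] is the image of a walk in [T1] to some [u], followed by a walk
    witnessing membership in the fiber of [u]. *)
Lemma star_VF v (F : set (edge T1)) : star (VF v F) = VF (aV v) (aE @` F).
Proof.
apply/seteqP; split=> w.
  move=> [u /VF_dwalk[q [vq Fq]] [r [ur ar]]]; apply/VF_dwalk.
  exists (map aE q ++ r); split.
    by apply/dwalk_cat; exists (aV u); split=> //; exact: dwalk_map.
  apply/avoids_cat; split=> [|_].
    case: q Fq {vq} => //= e q nFe [f Ff /alpha_mono.2 fe].
    by apply: nFe; rewrite -fe.
  (* If [q] is empty, the first edge of [r] lies outside the whole image, hence outside that of
     [F]. *)
  by case: r ar {ur} => //= e r nRe [f _ fe]; apply: nRe; exists f.
move=> /VF_dwalk[p [/dwalk_split[q [u [r [-> vq ur ar]]]]]].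
move=> /avoids_cat[Fq _]; exists u; last by exists r.
apply/VF_dwalk; exists q; split=> //.
by case: q Fq {vq} => //= e q nFe Fe; apply: nFe; exists e.
Qed.

Lemma star_setU A B : star (A `|` B) = star A `|` star B.
Proof. exact: bigcup_setU. Qed.

Lemma star_setI A B : star (A `&` B) = star A `&` star B.
Proof.
apply/seteqP; split=> [w [u [Au Bu] uw]|w [[u Au uw] [u' Bu' uw']]].
  by split; exists u.
by exists u => //; split=> //; rewrite (fiber_inj uw uw').
Qed.

Lemma star_setD A B : star (A `\` B) = star A `\` star B.
Proof.
apply/seteqP; split=> [w [u [Au nBu] uw]|w [[u Au uw] nBw]].
  split; first by exists u.
  by move=> [u' Bu' uw']; apply: nBu; rewrite (fiber_inj uw uw').
by exists u => //; split=> // Bu; apply: nBw; exists u.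
Qed.

(** The point [aV u] lies in the fiber of [u] and in no other, so it detects whether [u] belongs to
    the set. *)
Lemma star_inj : injective star.
Proof.
suff sub A B : star A = star B -> A `<=` B.
  by move=> A B AB; apply/seteqP; split; apply: sub.
move=> AB u Au; have : star A (aV u) by exists u => //; exact: fiber_on_vertex.
by rewrite AB => -[u' Bu' u'u]; rewrite (fiber_inj (fiber_on_vertex u) u'u).
Qed.

Lemma star_calE A : calE T1 A -> calE T2 (star A).
Proof.
move=> [[v [F [FD Ffin ->]]]|->]; last by right; rewrite /star bigcup_set0.
left; exists (aV v), (aE @` F); split; last exact: star_VF.
  by move=> _ [e /FD De <-]; apply/Delta1_on_edge.
exact: finite_image.
Qed.

Lemma star_calA A : calA T1 A -> calA T2 (star A).
Proof.
move=> [n [B [BE Btriv ->]]]; exists n, (star \o B); split.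
- by move=> i; exact: star_calE.
- move=> i j _ _ /= [w [[u Bu uw] [u' Bu' uw']]]; apply: Btriv => //.
  by exists u; split=> //; rewrite (fiber_inj uw uw').
- exact: bigcup_bigcup.
Qed.

Lemma star_star_formulas : star_formulas alpha star.
Proof. by split=> [v F _ _|n B _ _]; [exact: star_VF|exact: bigcup_bigcup]. Qed.

(** The formulas fix the values on [calE], with [set0] reached as the empty union, and thus on
    disjoint unions. *)
Lemma star_formulas_uniq f g A :
  star_formulas alpha f -> star_formulas alpha g -> calA T1 A -> f A = g A.
Proof.
have set0E h : star_formulas alpha h -> h set0 = set0.
  move=> [_ /(_ 0 (fun=> set0))].
  have bigcup_ord0 (Y : Type) (F : 'I_0 -> set Y) : \bigcup_i F i = set0.
    by rewrite -subset0 => x [[]].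
  by rewrite !bigcup_ord0; apply=> [[]|[]].
move=> fP gP [n [B [BE Btriv ->]]]; rewrite fP.2 // gP.2 //.
apply: eq_bigcupr => i _; have [[v [F [FD Ffin ->]]]|->] := BE i.
  by rewrite fP.1 // gP.1.
by rewrite !set0E.
Qed.

End Monomorphism.

Theorem lemma1p18 (T1 T2 : digraph) (treeT1 : is_tree T1) (treeT2 : is_tree T2)
    (alpha : dimorphism T1 T2) (alpha_mono : monomorphism alpha) :
  exists alpha_star : set (vertex T1) -> set (vertex T2),
    [/\ star_formulas alpha alpha_star,
        forall g, star_formulas alpha g ->
          forall A, calA T1 A -> g A = alpha_star A
      & boolean_ring_mono (calA T1) (calA T2) alpha_star].
Proof.
have starP := star_star_formulas alpha_mono.
exists (star alpha); split=> // [g gP A|]; first exact: star_formulas_uniq gP starP.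
split; last by move=> A B _ _; exact: star_inj.
split; [exact: calA_setring|exact: calA_setring|by move=> A; exact: star_calA|].
by move=> A B _ _; rewrite star_setU star_setI // star_setD.
Qed.
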